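(* Let $R$ be a unital ring and let $M$ be a projective supplemented right $R$-module that is a $D_2$-module. If every supplement submodule of $M$ is a direct summand of $M$, then $M$ is a $C$-$Rad$-$D_{11}$-module.
   Context: All rings are unital and all modules are right modules. $Rad(L)$ denotes the Jacobson radical of a module $L$ (the sum of all its small submodules). A submodule $N$ of $M$ is a supplement of a submodule $K$ in $M$ if $N+K=M$ and $N$ is minimal with respect to this property; a supplement submodule of $M$ is a submodule that is a supplement of some submodule of $M$. $M$ is supplemented if every submodule of $M$ has a supplement in $M$. A module $M$ is a $D_2$-module if whenever $A\le M$ is a submodule such that $M/A$ is isomorphic to a direct summand of $M$, then $A$ is a direct summand of $M$. For submodules $N,L$ of $M$, $L$ is a $Rad$-supplement of $N$ in $M$ if $N+L=M$ and $N\cap L\subseteq Rad(L)$. A module $M$ is a $Rad$-$D_{11}$-module if every submodule of $M$ has a $Rad$-supplement in $M$ that is a direct summand of $M$. A module $M$ is a $C$-$Rad$-$D_{11}$-module if every direct summand of $M$ is a $Rad$-$D_{11}$-module. *)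

(* Defs.v *)
From HB Require Import structures.
From mathcomp Require Import all_boot all_algebra.
From mathcomp Require Import boolp classical_sets.
Set Implicit Arguments.
Unset Strict Implicit.
Unset Printing Implicit Defensive.
Import GRing.Theory.
Local Open Scope ring_scope.
Local Open Scope classical_set_scope.

(* Everything is developed for MathComp's lmodType R, the left R-modules.  A  *)
(* right R-module is an M : lmodType R^c, where R^c is the opposite ring: the *)
(* action v.a is written a *: v with a : R^c, so that v.(a b) = (v.a).b.      *)
(* pzRingType is the class of unital rings, with 1 = 0 allowed.               *)

Record submodule (R : pzRingType) (M : lmodType R) := Submodule {
  submod_set :> set M;
  submod_setP : submod_closed [in submod_set]
}.

Section SubQuotient.
Context {R : pzRingType} {M : lmodType R} (N : submodule M).

Definition submod_pred : {pred M} := fun x => x \in submod_set N.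

HB.instance Definition _ :=
  GRing.isSubmodClosed.Build R M submod_pred (submod_setP N).

Definition submod_type := {x : M | x \in submod_pred}.
HB.instance Definition _ := SubChoice.on submod_type.
HB.instance Definition _ := [SubChoice_isSubLmodule of submod_type by <:].

(* The quotient module M / N: MathComp has the additive group, and the action *)
(* of R is the one induced on representatives.                                *)
Definition quotmod := Quotient.quot submod_pred.
HB.instance Definition _ := GRing.Zmodule.on quotmod.

Definition quotmod_proj (x : M) : quotmod := (\pi_(quotmod) x)%qT.

Definition quotmod_scale (a : R) (q : quotmod) : quotmod :=
  quotmod_proj (a *: (repr q : M)).

Lemma quotmod_projP (x y : M) :
  quotmod_proj x = quotmod_proj y <-> x - y \in submod_pred.
Proof.
rewrite (Quotient.idealrBE submod_pred x y).
by split=> [?|/eqP]; first exact/eqP.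
Qed.

Lemma quotmod_reprK (q : quotmod) : quotmod_proj (repr q) = q.
Proof. exact: reprK. Qed.

Lemma quotmod_proj_is_zmod_morphism : zmod_morphism quotmod_proj.
Proof. by move=> x y; rewrite /quotmod_proj -(raddfB (\pi_(quotmod)%qT)). Qed.
HB.instance Definition _ := GRing.isZmodMorphism.Build M quotmod quotmod_proj
  quotmod_proj_is_zmod_morphism.

Lemma quotmod_proj_scale (a : R) (x : M) :
  quotmod_scale a (quotmod_proj x) = quotmod_proj (a *: x).
Proof.
apply/quotmod_projP; rewrite -scalerBr; apply: rpredZ.
by apply/quotmod_projP; rewrite quotmod_reprK.
Qed.

Fact quotmod_scaleA a b q :
  quotmod_scale a (quotmod_scale b q) = quotmod_scale (a * b) q.
Proof. by rewrite -[q]quotmod_reprK !quotmod_proj_scale scalerA. Qed.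

Fact quotmod_scale1 : left_id 1 quotmod_scale.
Proof. by move=> q; rewrite -[q]quotmod_reprK quotmod_proj_scale scale1r. Qed.

Fact quotmod_scaleDr : right_distributive quotmod_scale +%R.
Proof.
move=> a p q; rewrite -[p]quotmod_reprK -[q]quotmod_reprK.
by rewrite -raddfD !quotmod_proj_scale scalerDr raddfD.
Qed.

Fact quotmod_scaleDl q : {morph quotmod_scale^~ q : a b / a + b}.
Proof.
move=> a b; rewrite -[q]quotmod_reprK.
by rewrite !quotmod_proj_scale scalerDl raddfD.
Qed.

HB.instance Definition _ := GRing.Zmodule_isLmodule.Build R quotmod
  quotmod_scaleA quotmod_scale1 quotmod_scaleDr quotmod_scaleDl.

End SubQuotient.
Arguments submod_type {R M} N.
Arguments quotmod {R M} N.

Definition sum_set {R : pzRingType} {M : lmodType R} (A B : set M) : set M :=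
  [set x + y | x in A & y in B].

Definition projective {R : pzRingType} (M : lmodType R) : Prop :=
  forall (A B : lmodType R) (g : {linear A -> B}) (f : {linear M -> B}),
    (forall b, exists a, g a = b) ->
    exists h : {linear M -> A}, forall x, g (h x) = f x.

Section Submodules.
Context {R : pzRingType} {M : lmodType R}.
Implicit Types K L N S X A B : submodule M.

Definition small_submodule S : Prop :=
  forall X, sum_set S X = setT -> X = setT :> set M.

Definition direct_summand N : Prop :=
  exists L, sum_set N L = setT /\ N `&` L = [set 0].

Definition is_supplement N K : Prop :=
  sum_set N K = setT /\
  forall X, X `<=` N -> sum_set X K = setT -> X = N :> set M.

Definition supplement_submodule N : Prop := exists K, is_supplement N K.

End Submodules.

(* Elements of the sum of the small submodules are the finite sums of         *)
(* elements each of which lies in some small submodule.                       *)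
Definition Rad {R : pzRingType} (L : lmodType R) : set L :=
  [set x | exists s : seq L,
     (forall y, y \in s ->
        exists S : submodule L, small_submodule S /\ (S : set L) y) /\
     x = \sum_(y <- s) y].
Arguments Rad {R} L.

(* Rad L, a subset of the module L, is transported to M along the inclusion.  *)
Definition Rad_supplement {R : pzRingType} {M : lmodType R}
    (L N : submodule M) : Prop :=
  sum_set N L = setT /\ N `&` L `<=` [set \val x | x in Rad (submod_type L)].

Definition supplemented {R : pzRingType} (M : lmodType R) : Prop :=
  forall K : submodule M, exists N : submodule M, is_supplement N K.

Definition isomorphic {R : pzRingType} (A B : lmodType R) : Prop :=
  exists f : {linear A -> B}, bijective f.

Definition D2_module {R : pzRingType} (M : lmodType R) : Prop :=
  forall A B : submodule M, direct_summand B ->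
    isomorphic (quotmod A) (submod_type B) -> direct_summand A.

Definition Rad_D11_module {R : pzRingType} (M : lmodType R) : Prop :=
  forall N : submodule M,
    exists L : submodule M, Rad_supplement L N /\ direct_summand L.

Definition C_Rad_D11_module {R : pzRingType} (M : lmodType R) : Prop :=
  forall N : submodule M, direct_summand N -> Rad_D11_module (submod_type N).

(* Main.v *)
Require Import Defs.
From mathcomp Require Import all_boot all_algebra.
From mathcomp Require Import boolp classical_sets.
Local Open Scope ring_scope.

(** The Rad-supplements in a direct summand [D] of [M] come from ordinary
    supplements in [M].  Write [M = D + D'] with [D] and [D'] disjoint, let
    [N] lie in [D], and let [K] be a supplement of [N + D'] in [M].  The
    projection of [K] to [D] along [D'] is [L = (K + D') `&` D]; it is again a
    supplement of [N + D'] in [M] ([projection_supplement]), and it now lies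
    inside [D].  Being a supplement submodule of [M], [L] is a direct summand
    of [M], hence of [D] by the modular law ([direct_summand_within]).
    Likewise [L] is a supplement of [N] in [D] ([supplement_within]).  Finally
    a supplement [L] of [N] meets [N] in a small submodule of [L], so inside
    [Rad L] ([supplement_Rad_supplement]). *)

Import GRing.Theory.
Local Open Scope classical_set_scope.
Set Implicit Arguments.
Unset Strict Implicit.
Unset Printing Implicit Defensive.

Section SubmoduleOperations.
Context {R : pzRingType} {M : lmodType R}.
Implicit Types N K : submodule M.

Lemma submodule0 N : (N : set M) 0.
Proof. by have [h _] := submod_setP N; apply/set_mem. Qed.

Lemma submodule_lin N a x y :
  (N : set M) x -> (N : set M) y -> (N : set M) (a *: x + y).
Proof.
by have [_ h] := submod_setP N => Nx Ny; apply/set_mem/h; apply/mem_set.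
Qed.

Lemma submoduleD N x y : (N : set M) x -> (N : set M) y -> (N : set M) (x + y).
Proof. by move=> Nx Ny; rewrite -[x]scale1r; apply: submodule_lin. Qed.

Lemma submoduleB N x y : (N : set M) x -> (N : set M) y -> (N : set M) (x - y).
Proof. by move=> Nx Ny; rewrite addrC -scaleN1r; apply: submodule_lin. Qed.

Lemma submod_closedP (A : set M) :
  A 0 -> (forall a x y, A x -> A y -> A (a *: x + y)) ->
  submod_closed [in A].
Proof.
move=> A0 Alin; split; first exact/mem_set.
by move=> a x y /set_mem Ax /set_mem Ay; apply/mem_set/Alin.
Qed.

Lemma sum_setP (A B : set M) :
  sum_set A B = setT <->
  forall m, exists a b, [/\ A a, B b & m = a + b].
Proof.
split=> [AB m | AB].
  have : setT m by [].
  by rewrite -AB => -[a Aa [b Bb <-]]; exists a, b.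
by apply/seteqP; split=> // m _; have [a [b [Aa Bb ->]]] := AB m;
  exists a => //; exists b.
Qed.

Lemma sum_submod_closed N K : submod_closed [in sum_set N K].
Proof.
apply: submod_closedP.
  exists 0; first exact: submodule0.
  by exists 0; [exact: submodule0 | rewrite addr0].
move=> a _ _ [x Nx [y Ky <-]] [x' Nx' [y' Ky' <-]].
exists (a *: x + x'); first exact: submodule_lin.
exists (a *: y + y'); first exact: submodule_lin.
by rewrite scalerDr addrACA.
Qed.
Definition sum_submod N K : submodule M := Submodule (sum_submod_closed N K).

Lemma meet_submod_closed N K : submod_closed [in (N : set M) `&` K].
Proof.
apply: submod_closedP; first by split; exact: submodule0.
by move=> a x y [Nx Kx] [Ny Ky]; split; apply: submodule_lin.
Qed.
Definition meet_submod N K : submodule M := Submodule (meet_submod_closed N K).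

End SubmoduleOperations.

Section LinearTransport.
Context {R : pzRingType} {M M' : lmodType R} (f : {linear M -> M'}).

Lemma image_submod_closed (N : submodule M) : submod_closed [in f @` N].
Proof.
apply: submod_closedP; first by exists 0; [exact: submodule0 | rewrite linear0].
move=> a _ _ [x Nx <-] [y Ny <-].
by exists (a *: x + y); [exact: submodule_lin | rewrite linearP].
Qed.
Definition image_submod (N : submodule M) : submodule M' :=
  Submodule (image_submod_closed N).

Lemma preimage_submod_closed (N : submodule M') : submod_closed [in f @^-1` N].
Proof.
apply: submod_closedP; first by rewrite /preimage/= linear0; exact: submodule0.
by move=> a x y Nx Ny; rewrite /preimage/= linearP; apply: submodule_lin.
Qed.
Definition preimage_submod (N : submodule M') : submodule M :=
  Submodule (preimage_submod_closed N).

Lemma preimage_submodE (N : submodule M') x :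
  (preimage_submod N : set M) x = (N : set M') (f x).
Proof. by []. Qed.

End LinearTransport.

Section Inclusion.
Context {R : pzRingType} {M : lmodType R} (D : submodule M).

Definition incl : {linear submod_type D -> M} := \val.

Lemma inclP (x : submod_type D) : (D : set M) (incl x).
Proof. exact: set_mem (valP x). Qed.

Lemma incl_inj : injective incl.
Proof. exact: val_inj. Qed.

Lemma incl_onto (m : M) : (D : set M) m -> exists x, incl x = m.
Proof. by move=> /mem_set Dm; exists (Sub m Dm); exact: SubK. Qed.

End Inclusion.

Lemma small_submodule_sub_Rad (R : pzRingType) (M : lmodType R)
    (N : submodule M) :
  small_submodule N -> (N : set M) `<=` Rad M.
Proof.
move=> smallN x Nx; exists [:: x]; split; last by rewrite big_seq1.
by move=> y; rewrite inE => /eqP ->; exists N.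
Qed.

Section Supplements.
Context {R : pzRingType} {M : lmodType R}.
Implicit Types N K L D : submodule M.

(** If [X] is a submodule of [L] with [X + (N `&` L) = L] then
    [X + N = L + N = M], so [X = L] by minimality: [N `&` L] is small in [L]. *)
Lemma supplement_Rad_supplement L N : is_supplement L N -> Rad_supplement L N.
Proof.
move=> [/sum_setP LN minL]; split.
  apply/sum_setP => m; have [l [n [Ll Nn ->]]] := LN m.
  by exists n, l; rewrite addrC.
pose S : submodule (submod_type L) := preimage_submod (incl L) N.
suff smallS : small_submodule S.
  move=> x [Nx /incl_onto[y yx]]; exists y => //.
  by apply: (small_submodule_sub_Rad smallS); rewrite preimage_submodE yx.
move=> X /sum_setP SX; pose X' := image_submod (incl L) X.
have X'L : X' = L :> set M.
  apply: minL => [_ [x _ <-]|]; first exact: inclP.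
  apply/sum_setP => m; have [l [n [/incl_onto[y <-] Nn ->]]] := LN m.
  have [s [x [Ss Xx ->]]] := SX y.
  exists (incl L x), (incl L s + n); split; first by exists x.
    exact: submoduleD.
  by rewrite linearD addrA [incl L x + _]addrC.
apply/seteqP; split=> // y _.
have : (X' : set M) (incl L y) by rewrite X'L; exact: inclP.
by case=> x Xx /incl_inj <-.
Qed.

Lemma eq_of_sub_in_complement D D' x d :
  (D : set M) `&` D' = [set 0] ->
  (D : set M) x -> (D : set M) d -> (D' : set M) (x - d) -> x = d.
Proof.
move=> DD' Dx Dd D'xd; apply/eqP; rewrite -subr_eq0; apply/eqP.
have : ((D : set M) `&` D') (x - d) by split=> //; exact: submoduleB.
by rewrite DD'.
Qed.

(** [(K + D') `&` D] is the image of [K] under the projection to [D] along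
    [D'].  It has the same sum with [D'] as [K], which gives the
    decomposition of [M]; and a smaller [X] pulls back to the submodule
    [K `&` (X + D')] of [K], to which the minimality of [K] applies. *)
Lemma projection_supplement D D' N K :
  sum_set D D' = setT -> (D : set M) `&` D' = [set 0] ->
  is_supplement K (sum_submod N D') ->
  is_supplement (meet_submod (sum_submod K D') D) (sum_submod N D').
Proof.
move=> /sum_setP DD' disj [/sum_setP KN minK]; split.
  apply/sum_setP => m; have [k [_ [Kk [n Nn [d' D'd' <-]] ->]]] := KN m.
  have [d [e [Dd D'e kE]]] := DD' k.
  exists d, (n + (d' + e)); split.
  - split=> //; exists k => //; exists (0 - e).
      by apply: submoduleB => //; exact: submodule0.
    by rewrite sub0r kE addrK.
  - by exists n => //; exists (d' + e) => //; exact: submoduleD.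
  - by rewrite kE -addrA; congr (_ + _); rewrite addrC addrA.
move=> X XL /sum_setP XN.
have KX : meet_submod K (sum_submod X D') = K :> set M.
  apply: minK => [x [] //|]; apply/sum_setP => m.
  have [x [_ [Xx [n Nn [d' D'd' <-]] ->]]] := XN m.
  have [[k Kk [e D'e xE]] _] := XL x Xx.
  exists k, (n + (d' + e)); split.
  - split=> //; exists x => //; exists (0 - e).
      by apply: submoduleB => //; exact: submodule0.
    by rewrite sub0r -xE addrK.
  - by exists n => //; exists (d' + e) => //; exact: submoduleD.
  - by rewrite -xE -addrA; congr (_ + _); rewrite addrC addrA.
apply/seteqP; split=> // l [[k Kk [e D'e lE]] Dl].
have : (meet_submod K (sum_submod X D') : set M) k by rewrite KX.
move=> [_ [x Xx [e' D'e' kE]]].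
have [_ Dx] := XL x Xx.
(* [l] and [x] lie in [D] and differ by an element of [D'] *)
rewrite (eq_of_sub_in_complement disj Dl Dx) //.
by rewrite -lE -kE -[x + e' + e]addrA addrAC subrr add0r; exact: submoduleD.
Qed.

(** The modular law: if [M = L + Q] is direct and [L] lies in [D], then
    [D = L + (Q `&` D)] is direct. *)
Lemma direct_summand_within D L :
  (L : set M) `<=` D -> direct_summand L ->
  direct_summand (preimage_submod (incl D) L).
Proof.
move=> LD [Q [/sum_setP LQ disj]]; exists (preimage_submod (incl D) Q); split.
  apply/sum_setP => x; have [l [q [Ll Qq xE]]] := LQ (incl D x).
  have [y yE] := incl_onto (LD l Ll).
  have incl_xy : incl D (x - y) = q by rewrite linearB xE yE addrAC subrr add0r.
  exists y, (x - y); split; rewrite ?preimage_submodE ?yE ?incl_xy //.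
  by rewrite addrC subrK.
apply/seteqP; split=> [x [Lx Qx]|_ ->]; last by split; exact: submodule0.
apply: (@incl_inj _ _ D); rewrite linear0.
by have : ((L : set M) `&` Q) (incl D x) by []; rewrite disj.
Qed.

(** Decompositions and minimality pass between [D] and [M] because [D] is
    disjoint from [D'], so that [X + N + D' = M] is the same as [X + N = D]
    for [X] inside [D]. *)
Lemma supplement_within D D' L (N : submodule (submod_type D)) :
  sum_set D D' = setT -> (D : set M) `&` D' = [set 0] ->
  (L : set M) `<=` D ->
  is_supplement L (sum_submod (image_submod (incl D) N) D') ->
  is_supplement (preimage_submod (incl D) L) N.
Proof.
move=> /sum_setP DD' disj LD [/sum_setP LN minL]; split.
  apply/sum_setP => x.
  have [l [_ [Ll [_ [n Nn <-] [d' D'd' <-]] xE]]] := LN (incl D x).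
  have [y yE] := incl_onto (LD l Ll).
  exists y, n; split=> //; first by rewrite preimage_submodE yE.
  apply: (@incl_inj _ _ D).
  apply: (eq_of_sub_in_complement disj); [exact: inclP | exact: inclP |].
  by rewrite (linearD (incl D)) yE xE addrA [_ + d']addrC addrK.
move=> X XL /sum_setP XN; pose X' := image_submod (incl D) X.
have X'L : X' = L :> set M.
  apply: minL => [_ [x Xx <-]|]; first exact: XL.
  apply/sum_setP => m; have [_ [d' [/incl_onto[y <-] D'd' ->]]] := DD' m.
  have [x [n [Xx Nn ->]]] := XN y.
  exists (incl D x), (incl D n + d'); split; first by exists x.
    by exists (incl D n); [exists n | exists d'].
  by rewrite linearD addrA.
apply/seteqP; split=> // y Ly.
have : (X' : set M) (incl D y) by rewrite X'L.
by case=> x Xx /incl_inj <-.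
Qed.

End Supplements.

Theorem theorem2p8 (R : pzRingType) (M : lmodType R^c) :
  projective M -> supplemented M -> D2_module M ->
  (forall N : submodule M, supplement_submodule N -> direct_summand N) ->
  C_Rad_D11_module M.
Proof.
move=> _ supM _ summand D [D' [DD' disj]] N.
pose T := sum_submod (image_submod (incl D) N) D'.
have [K supK] := supM T.
have supL := projection_supplement DD' disj supK.
set L := meet_submod _ D in supL.
have LD : (L : set M) `<=` D by move=> x [].
exists (preimage_submod (incl D) L); split.
  exact/supplement_Rad_supplement/(supplement_within DD' disj LD supL).
by apply: direct_summand_within => //; apply: summand; exists T.
Qed.
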